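(* For a positive integer $p$ and $n\ge 0$, let $a(n,p)$ be the total number of parts congruent to $0 \pmod{p}$, counted over all partitions of $n$ in which every part appears at most $p-1$ times. Then for all $n \geq 0$, $$a(5n+4,5) \equiv 0 \pmod{5},\qquad a(7n+5,7) \equiv 0 \pmod{7},\qquad a(11n+6,11) \equiv 0 \pmod{11}.$$ *)

(* Defs.v *)
From HB Require Import structures.
From mathcomp Require Import all_boot.

Set Implicit Arguments.
Unset Strict Implicit.
Unset Printing Implicit Defensive.

Definition is_partition (n : nat) (s : seq nat) : bool :=
  [&& sorted geq s, all (ltn 0) s & sumn s == n].

(* Repeated occurrences of a part are consecutive entries of [s], so
   [count_mem i s] is the multiplicity of the part [i]. *)
Definition mult_le (k : nat) (s : seq nat) : bool :=
  all (fun i => count_mem i s <= k) s.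

(* A partition of [n] has at most [n] parts, each at most [n]; hence
   [{bseq n of 'I_n.+1}] contains each partition of [n] exactly once, see
   [bpartition_surj] and [bpartition_inj] below. *)
Definition bparts (n : nat) (s : {bseq n of 'I_n.+1}) : seq nat :=
  [seq val i | i <- s].

(* Parts are counted with multiplicity. *)
Definition a (n p : nat) : nat :=
  \sum_(s : {bseq n of 'I_n.+1} |
          is_partition n (bparts s) && mult_le p.-1 (bparts s))
     count (fun i => i == 0 %[mod p]) (bparts s).

Lemma bpartition_inj (n : nat) : injective (@bparts n).
Proof. by move=> s t /(inj_map val_inj) /val_inj. Qed.

Lemma bpartition_surj (n : nat) (s : seq nat) :
  is_partition n s -> exists t : {bseq n of 'I_n.+1}, bparts t = s.
Proof.
case/and3P=> _ s_gt0 /eqP sum_s.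
have size_s : size s <= n.
  rewrite -{}sum_s; elim: s s_gt0 => //= x s IHs /andP[x_gt0 /IHs le_s].
  by rewrite -add1n leq_add.
have le_s x : x \in s -> x <= n.
  rewrite -{}sum_s {s_gt0 size_s}; elim: s => //= y s IHs.
  rewrite inE => /predU1P[->|/IHs le_x]; first exact: leq_addr.
  exact: leq_trans le_x (leq_addl _ _).
have size_t : size (map (@inord n) s) <= n by rewrite size_map.
exists (Bseq size_t); rewrite /bparts /= -map_comp.
by rewrite -[RHS]map_id; apply/eq_in_map => x /le_s le_xn /=; rewrite inordK.
Qed.

(* Main.v *)
(* If part i is used at most p-1 times, it contributes the factor
   1 + x + ... + x^(p-1) with x = q^i, which is (1 - x)^(p-1) modulo p; marking
   its multiplicity gives sum_(k<p) k x^k = x (1 - x)^(p-2) modulo p. Hence the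
   generating function of a(n,p) is modulo p a series in q^p times E^(p-1),
   where E = prod_i (1 - q^i), and it suffices that E^(p-1) has no exponents
   congruent to n modulo p. Power series are polynomials compared below q^N.

   By the pentagonal number theorem (Shanks's finite form) 24 i + 1 is a square
   for all exponents i of E; by Jacobi's identity (differentiating the finite
   q-binomial theorem at -1) E^3 = sum_k (-1)^k (2k+1) q^(k(k+1)/2), so that
   modulo p its exponents i have 8 i + 1 a nonzero square. This settles
   E^4 = E^3 E modulo 5 and E^6 = E^3 E^3 modulo 7.

   Modulo 11 write E^3 = x0 + x1 + x3 + x6 + x10 by the residue of exponents.
   Since (E^3)^4 = E^11 E and E^11 is a series in q^11, the components of
   (E^3)^4 in the classes 3, 6, 8, 9, 10 vanish: five quartic relations between
   the x_r. The component of class 6 of (E^3)^7 = E^11 E^10 lies in the ideal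
   they generate modulo 11, so it vanishes, and so does that of E^10. *)
Require Import Defs.
From HB Require Import structures.
From mathcomp Require Import all_boot all_algebra.
From mathcomp Require Import zify ring.

Set Implicit Arguments.
Unset Strict Implicit.
Unset Printing Implicit Defensive.

(** * Partitions as multiplicity functions *)

Lemma partition_bound n s : is_partition n s -> all (fun x => 0 < x <= n) s.
Proof.
case/and3P=> _ /allP s_gt0 /eqP <-; apply/allP => x xs.
have -> /= : 0 < x by apply: s_gt0.
elim: s xs {s_gt0} => //= y s IHs; rewrite inE => /predU1P[-> | /IHs le_x].
  exact: leq_addr.
exact: leq_trans le_x (leq_addl _ _).
Qed.

Lemma sum_count_mem n (s : seq nat) (w : nat -> nat) :
  all (fun x => 0 < x <= n) s ->
  \sum_(x <- s) w x = \sum_(i < n) w i.+1 * count_mem i.+1 s.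
Proof.
elim: s => [|x s IHs] /=.
  by rewrite big_nil big1 // => i _; rewrite muln0.
case/andP=> /andP[x_gt0 le_xn] /IHs eq_s; rewrite big_cons {}eq_s.
under [in RHS]eq_bigr => i _ do rewrite mulnDr.
rewrite big_split /=; congr (_ + _).
have x1n : x.-1 < n by rewrite prednK.
rewrite (bigD1 (Ordinal x1n)) //= prednK // eqxx muln1 big1 ?addn0 // => i ix.
rewrite (_ : x == i.+1 = false) ?muln0 //; apply: contraNF ix => /eqP xi.
by apply/eqP/val_inj; rewrite /= xi.
Qed.

(** Index [i] stands for the part [i.+1]. [inord] is faithful only when no multiplicity exceeds [k],
    which is what [mult_le k] provides. *)
Definition multiplicities n k (s : {bseq n of 'I_n.+1}) :
    {ffun 'I_n -> 'I_k.+1} :=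
  [ffun i : 'I_n => inord (count_mem i.+1 (bparts s))].

Lemma multiplicitiesE n k (s : {bseq n of 'I_n.+1}) (i : 'I_n) :
  mult_le k (bparts s) ->
  multiplicities k s i = count_mem i.+1 (bparts s) :> nat.
Proof.
move=> /allP le_k; rewrite ffunE inordK // ltnS.
have [/le_k // | /count_memPn -> //] := boolP (i.+1 \in bparts s).
Qed.

Lemma multiplicities_inj n k :
  {in [pred s | is_partition n (@bparts n s) && mult_le k (bparts s)] &,
    injective (@multiplicities n k)}.
Proof.
move=> s t /andP[Ps ms] /andP[Pt mt] eq_st.
apply: bpartition_inj; apply: (sorted_eq (leT := geq)).
- by move=> x y z /= xy yz; apply: leq_trans yz xy.
- by move=> x y /anti_leq.
- by case/and3P: Ps.
- by case/and3P: Pt.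
have [Bs Bt] := (partition_bound Ps, partition_bound Pt).
(* [perm_eq] unfolds to equality of counts; values outside 1..n occur in neither list. *)
apply/allP => x _ /=; apply/eqP.
have [/andP[x_gt0 le_xn] | xn] := boolP (0 < x <= n); last first.
  have xs : x \notin bparts s by apply: contraNN xn; apply: (allP Bs).
  have xt : x \notin bparts t by apply: contraNN xn; apply: (allP Bt).
  by rewrite (count_memPn xs) (count_memPn xt).
have x1n : x.-1 < n by rewrite prednK.
have := congr1 (fun f : {ffun 'I_n -> 'I_k.+1} => f (Ordinal x1n) : nat) eq_st.
by rewrite !multiplicitiesE //= prednK.
Qed.

Lemma multiplicities_surj n k (f : {ffun 'I_n -> 'I_k.+1}) :
  \sum_(i < n) i.+1 * f i = n ->
  exists2 s, is_partition n (@bparts n s) && mult_le k (bparts s)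
           & f = multiplicities k s.
Proof.
(* The preimage lists [f i] copies of each part [i.+1]; sorting it makes it a partition. *)
move=> wf; pose t := flatten [seq nseq (f i) i.+1 | i <- enum 'I_n].
have count_t (j : 'I_n) : count_mem j.+1 t = f j.
  rewrite /t count_flatten -map_comp sumnE big_map big_enum /=.
  rewrite (bigD1 j) //= count_nseq /= eqxx mul1n big1 ?addn0 // => i ij.
  by rewrite count_nseq /= eqSS (inj_eq val_inj) (negPf ij).
have mem_t x : x \in t -> exists i : 'I_n, x = i.+1.
  by case/flatten_mapP=> i _; rewrite mem_nseq => /andP[_ /eqP ->]; exists i.
have Bt : all (fun x => 0 < x <= n) t by apply/allP => x /mem_t[i ->] /=.
have Pt : is_partition n (sort geq t).
  apply/and3P; split.
  - by apply: sort_sorted => x y; apply: leq_total.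
  - by rewrite all_sort; apply: sub_all Bt => x /andP[].
  rewrite (perm_sumn (permEl (perm_sort _ _))) sumnE.
  rewrite (sum_count_mem id Bt) -[X in _ == X]wf; apply/eqP.
  by apply: eq_bigr => i _; rewrite count_t.
have [s def_s] := bpartition_surj Pt.
have ms : mult_le k (bparts s).
  apply/allP => x; rewrite def_s mem_sort count_sort => /mem_t[i ->].
  by rewrite count_t -ltnS.
exists s; first by rewrite def_s Pt -def_s.
by apply/ffunP => i; apply: ord_inj;
  rewrite multiplicitiesE // def_s count_sort count_t.
Qed.

Lemma a_multiplicities n p :
  a n p = \sum_(f : {ffun 'I_n -> 'I_p.-1.+1} | \sum_(i < n) i.+1 * f i == n)
            \sum_(i < n | p %| i.+1) f i.
Proof.
pose A := [pred s | is_partition n (@bparts n s) && mult_le p.-1 (bparts s)].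
pose G (f : {ffun 'I_n -> 'I_p.-1.+1}) := \sum_(i < n | p %| i.+1) f i.
transitivity (\sum_(s in A) G (multiplicities p.-1 s)).
  apply: eq_bigr => s /andP[Ps ms]; rewrite -sum1_count big_mkcond /=.
  rewrite (sum_count_mem _ (partition_bound Ps)) /G [in RHS]big_mkcond /=.
  apply: eq_bigr => i _; rewrite multiplicitiesE // mod0n -/(dvdn _ _).
  by case: ifP; rewrite ?mul1n.
rewrite -(big_imset G (@multiplicities_inj n p.-1)); apply: eq_bigl => f.
apply/imsetP/eqP => [[s /andP[Ps ms] ->] | /multiplicities_surj[s sA ->]].
  transitivity (sumn (bparts s)); last by case/and3P: Ps => _ _ /eqP.
  rewrite sumnE (sum_count_mem id (partition_bound Ps)).
  by apply: eq_bigr => i _; rewrite multiplicitiesE.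
by exists s.
Qed.

Import GRing.Theory.
Local Open Scope ring_scope.

(** * Polynomials as truncated power series *)

Definition eqX (R : nzRingType) (N : nat) (A B : {poly R}) : Prop :=
  forall i, (i < N)%N -> A`_i = B`_i.

Lemma eqX_sym (R : nzRingType) N (A B : {poly R}) : eqX N A B -> eqX N B A.
Proof. by move=> AB i iN; rewrite AB. Qed.

Lemma eqX_trans (R : nzRingType) N (A B C : {poly R}) :
  eqX N A B -> eqX N B C -> eqX N A C.
Proof. by move=> AB BC i iN; rewrite AB ?BC. Qed.

Lemma eqXW (R : nzRingType) M N (A B : {poly R}) :
  (M <= N)%N -> eqX N A B -> eqX M A B.
Proof. by move=> MN AB i iM; apply: AB; apply: leq_trans MN. Qed.

Lemma eqXM (R : nzRingType) N (A B C D : {poly R}) :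
  eqX N A B -> eqX N C D -> eqX N (A * C) (B * D).
Proof.
move=> AB CD i iN; rewrite !coefM; apply: eq_bigr => j _.
have ji := ltn_ord j; rewrite AB ?CD //.
  exact: leq_ltn_trans (leq_subr _ _) iN.
by apply: leq_ltn_trans iN; rewrite -ltnS.
Qed.

Lemma eqX_exp (R : nzRingType) N m (A B : {poly R}) :
  eqX N A B -> eqX N (A ^+ m) (B ^+ m).
Proof. by move=> AB; elim: m => [|m IHm] //; rewrite !exprS; apply: eqXM. Qed.

Lemma eqX_sum (R : nzRingType) N (I : Type) (r : seq I) (P : pred I)
    (F G : I -> {poly R}) :
  (forall i, P i -> eqX N (F i) (G i)) ->
  eqX N (\sum_(i <- r | P i) F i) (\sum_(i <- r | P i) G i).
Proof.
by move=> FG i iN; rewrite !coef_sum; apply: eq_bigr => j Pj; apply: FG.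
Qed.

(** A series with constant term 1 can be cancelled: by strong induction on the degree, all terms of
    the convolution agree except the last, which is the sought coefficient times 1. *)
Lemma eqX_mulIf (R : nzRingType) N (U A B : {poly R}) :
  U`_0 = 1 -> eqX N (A * U) (B * U) -> eqX N A B.
Proof.
move=> U0 AB i; elim/ltn_ind: i => i IHi iN.
have := AB i iN; rewrite !coefM !big_ord_recr /= subnn U0 !mulr1.
rewrite (eq_bigr (fun j : 'I_i => B`_j * U`_(i - j))) => [/addrI // | j _].
by rewrite IHi ?ltn_ord //; apply: ltn_trans (ltn_ord _) iN.
Qed.

Lemma eqX_XnM0 (R : nzRingType) N m (A : {poly R}) :
  (N <= m)%N -> eqX N ('X^m * A) 0.
Proof. by move=> Nm i iN; rewrite coefXnM coef0 (leq_trans iN Nm). Qed.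

(** The q-factorial (q; q)_n with q = ['X]; it agrees with E below q^(n+1). *)
Definition qfact (R : nzRingType) (n : nat) : {poly R} :=
  \prod_(i < n) (1 - 'X^(i.+1)).

Lemma qfactS (R : nzRingType) n :
  qfact R n.+1 = qfact R n * (1 - 'X^(n.+1)).
Proof. by rewrite /qfact big_ord_recr. Qed.

Lemma qfact_coef0 (R : nzRingType) n : (qfact R n)`_0 = 1.
Proof.
elim: n => [|n IHn]; first by rewrite /qfact big_ord0 coef1.
by rewrite qfactS coefM big_ord1 IHn coefB coef1 coefXn subr0 mulr1.
Qed.

Lemma eqX_qfact (R : nzRingType) N m n :
  (N <= m.+1)%N -> (N <= n.+1)%N -> eqX N (qfact R m) (qfact R n).
Proof.
suff le_qfact k l : (N <= k.+1)%N -> eqX N (qfact R (k + l)) (qfact R k).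
  move=> Nm Nn; case: (leqP m n) => [mn | /ltnW nm].
    by apply: eqX_sym; rewrite -(subnKC mn); apply: le_qfact.
  by rewrite -(subnKC nm); apply: le_qfact.
move=> Nk; elim: l => [|l IHl]; first by rewrite addn0.
rewrite addnS qfactS; apply: eqX_trans IHl => i iN.
rewrite mulrBr mulr1 coefB coefMXn.
by have -> : (i < (k + l).+1)%N by [lia]; rewrite subr0.
Qed.

(** * Euler's pentagonal number theorem *)

(** With m = k+1 the exponents are the generalized pentagonal numbers m(3m-1)/2 and m(3m+1)/2. *)
Definition pentagonal_poly (R : nzRingType) (n : nat) : {poly R} :=
  1 + \sum_(k < n) (-1) ^+ k.+1 *
    ('X^(k.+1 * k.+1 + 'C(k.+1, 2)) + 'X^(k.+1 * k.+1 + 'C(k.+2, 2))).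

(* sum_(s <= n) of these equals the partial pentagonal sum, while all terms with
   s > 0 vanish below q^(n+1). *)
Definition shanks_term (R : nzRingType) (n s : nat) : {poly R} :=
  (-1) ^+ s * (\prod_(s <= i < n) (1 - 'X^(i.+1))) * 'X^(s * n + 'C(s.+1, 2)).

Lemma shanks_telescope (R : comNzRingType) n m : (m <= n)%N ->
  \sum_(s < m.+1) shanks_term R n.+1 s =
  \sum_(s < m.+1) shanks_term R n s
  - (-1) ^+ m * (\prod_(m <= i < n) (1 - 'X^(i.+1)))
    * 'X^(m.+1 * n.+1 + 'C(m.+1, 2)).
Proof.
elim: m => [|m IHm] mn.
  rewrite !big_ord_recr !big_ord0 /= /shanks_term big_nat_recr //=.
  by rewrite expr0 !mul0n !mul1n !addn0 !expr0; ring.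
rewrite big_ord_recr [in RHS]big_ord_recr /= IHm; last exact: ltnW.
rewrite /shanks_term big_nat_recr //= (big_ltn mn).
set P := \prod_(_ <= i < n) _; set S := \sum_(_ < _) _.
rewrite (binS m.+1 1) bin1; set c := 'C(m.+1, 2).
rewrite !mulSn !mulnS !exprD !exprS; ring.
Qed.

(** Going from n to n+1, [shanks_telescope] at m = n has an empty product and leaves the first new
    pentagonal term; the summand s = n+1 is the second. *)
Lemma shanks_pentagonal (R : comNzRingType) n :
  \sum_(s < n.+1) shanks_term R n s = pentagonal_poly R n.
Proof.
elim: n => [|n IHn].
  rewrite big_ord1 /pentagonal_poly big_ord0 /shanks_term big_geq //.
  by rewrite !mul1r addr0 expr0.
rewrite big_ord_recr /= shanks_telescope // IHn /pentagonal_poly.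
rewrite big_ord_recr /= /shanks_term !big_geq // (exprS (-1) n); ring.
Qed.

Lemma qfact_pentagonal (R : comNzRingType) n :
  eqX n.+1 (qfact R n) (pentagonal_poly R n).
Proof.
rewrite -shanks_pentagonal big_ord_recl /= => i iN; rewrite coefD coef_sum.
rewrite big1 ?addr0 => [|s _].
  by rewrite /shanks_term mul1r mul0n add0n expr0 mulr1 /qfact big_mkord.
rewrite /shanks_term coefMXn /bump /= add1n mulSn binS bin1.
by case: ltnP => //; lia.
Qed.

(** * Gaussian binomials and Jacobi's identity for E^3 *)

(** Gaussian binomial coefficients, defined by a Pascal rule to avoid division; the general base [q]
    lets ring morphisms act on them. *)
Fixpoint gbin (A : nzRingType) (q : A) (m j : nat) : A :=
  match m, j with
  | _, 0 => 1
  | 0, _.+1 => 0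
  | m'.+1, j'.+1 => q ^+ j * gbin q m' j + gbin q m' j'
  end.

Lemma gbin0 (A : nzRingType) (q : A) m : gbin q m 0 = 1.
Proof. by case: m. Qed.

Lemma gbin_small (A : nzRingType) (q : A) m j : (m < j)%N -> gbin q m j = 0.
Proof.
elim: m j => [|m IHm] [|j] //= mj.
by rewrite !IHm ?mulr0 ?addr0 // ltnW.
Qed.

Lemma gbin_rmorph (A B : nzRingType) (f : {rmorphism A -> B}) (q : A) m j :
  f (gbin q m j) = gbin (f q) m j.
Proof.
elim: m j => [|m IHm] [|j] //=; rewrite ?rmorph1 ?rmorph0 //.
by rewrite rmorphD rmorphM rmorphXn !IHm.
Qed.

(** Induction on m: after the factor a + b is split off, the remaining ones are those for q b, and
    the two resulting sums match the two terms of the Pascal rule. *)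
Lemma qbinomial (A : comNzRingType) (q a b : A) m :
  \prod_(i < m) (a + q ^+ i * b) =
  \sum_(j < m.+1) q ^+ 'C(j, 2) * gbin q m j * a ^+ (m - j) * b ^+ j.
Proof.
elim: m b => [|m IHm] b.
  by rewrite big_ord0 big_ord1 /= !mul1r.
rewrite big_ord_recl expr0 mul1r.
under eq_bigr => i _ do rewrite lift0 exprSr -mulrA.
rewrite IHm mulrDl [in RHS]big_ord_recl.
under [in RHS]eq_bigr => i _ do
  rewrite lift0 /= mulrDr !mulrDl.
rewrite big_split /= addrA; congr (_ + _).
  rewrite [in RHS]big_ord_recr /= (gbin_small _ (ltnSn m)) !(mulr0, mul0r).
  rewrite addr0 big_ord_recl.
  rewrite mulrDr gbin0 !mul1r !mulr1 !subn0 -exprS; congr (_ + _).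
  rewrite mulr_sumr; apply: eq_bigr => i _; rewrite lift0 subSS.
  have -> : (m - i)%N = (m - i.+1).+1 by rewrite subnSK.
  rewrite exprMn [a ^+ _.+1]exprS; ring.
rewrite mulr_sumr; apply: eq_bigr => i _.
rewrite subSS binS bin1 exprD exprMn exprS; ring.
Qed.

(** The Pascal rule reduces this to 1 - X^(m+1) = (1 - X^(j+1)) + X^(j+1) (1 - X^(m-j)). *)
Lemma gbin_qfact (R : comNzRingType) m j : (j <= m)%N ->
  gbin 'X m j * qfact R j * qfact R (m - j) = qfact R m.
Proof.
elim: m j => [|m IHm] [|j] //= jm.
- by rewrite mul1r /qfact big_ord0 mul1r.
- by rewrite mul1r {1}/qfact big_ord0 mul1r subn0.
rewrite subSS [in RHS]qfactS mulrDl mulrDl.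
have -> : gbin 'X m j * qfact R j.+1 * qfact R (m - j) =
          qfact R m * (1 - 'X^(j.+1)).
  by rewrite qfactS -(IHm j) //; ring.
move: jm; rewrite ltnS leq_eqVlt => /predU1P[-> | jm].
  by rewrite gbin_small // mulr0 !mul0r add0r.
have := subnSK jm; set d := (m - j.+1)%N => <-.
rewrite [qfact R d.+1]qfactS -(IHm _ jm) -/d.
have -> : 'X^(m.+1) = 'X^(j.+1) * 'X^(d.+1) :> {poly R}.
  by rewrite -exprD; congr ('X^ _); rewrite /d; lia.
ring.
Qed.

(** Take a = q^n, b = X and 2n+1 factors. The middle factor q^n (1 + X) vanishes at -1, so the
    derivative there is q^n times the product of the others. The truncated [j.-1] is harmless since
    the term j = 0 is zero. *)
Lemma qbinomial_deriv (A : comNzRingType) (q : A) n :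
  q ^+ n * (\prod_(i < n) (q ^+ n - q ^+ i)) *
    (\prod_(i < n) (q ^+ n - q ^+ (n + i.+1))) =
  \sum_(j < (n + n.+1).+1) q ^+ 'C(j, 2) * gbin q (n + n.+1) j *
    (q ^+ n) ^+ (n + n.+1 - j) * (-1) ^+ j.-1 *+ j.
Proof.
have := qbinomial (q%:P) ((q ^+ n)%:P) 'X (n + n.+1).
rewrite big_split_ord /= big_ord_recl /= addn0.
move=> /(congr1 (fun P : {poly A} => P^`().[-1])).
rewrite /= (raddf_sum (@deriv A)) horner_sum => eqd.
transitivity
  ((\prod_(i < n) ((q ^+ n)%:P + q%:P ^+ i * 'X) *
    (((q ^+ n)%:P + q%:P ^+ n * 'X) *
     \prod_(i < n) ((q ^+ n)%:P + q%:P ^+ (n + bump 0 i) * 'X)))^`().[-1]).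
  rewrite mulrCA -mulrA derivM.
  have -> : (q ^+ n)%:P + q%:P ^+ n * 'X = (q ^+ n)%:P * (1 + 'X).
    by rewrite -polyC_exp; ring.
  rewrite !hornerE !derivE !hornerE subrr.
  rewrite !(mul0r, mulr0, addr0, add0r, mulr1) /=.
  rewrite !horner_prod; congr (_ * _ * _); apply: eq_bigr => i _;
    by rewrite -polyC_exp !hornerE mulrN1 //= add1n.
rewrite {}eqd; apply: eq_bigr => j _.
rewrite -(gbin_rmorph (@polyC A)) -!polyC_exp -!polyCM.
rewrite /= derivM derivC mul0r add0r derivXn.
by rewrite hornerM hornerC hornerMn hornerXn mulrnAr.
Qed.

Lemma prod_subXn (R : comNzRingType) n :
  \prod_(i < n) ('X^n - 'X^i) = (-1) ^+ n * 'X^('C(n, 2)) * qfact R n.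
Proof.
have -> : 'C(n, 2) = (\sum_(i < n) i)%N.
  by rewrite -bin2_sum big_mkord.
have -> : (-1) ^+ n = \prod_(i < n) (-1) :> {poly R}.
  by rewrite prodr_const card_ord.
rewrite -prodrXr /qfact.
rewrite (reindex_inj rev_ord_inj (F := fun i : 'I_n => 1 - 'X^(i.+1))) /=.
rewrite -!big_split /=; apply: eq_bigr => i _.
rewrite subnSK // mulN1r mulNr mulrBr mulr1 -exprD subnKC ?opprB //.
exact: ltnW.
Qed.

Lemma bin2D m n : 'C(m + n, 2) = ('C(m, 2) + 'C(n, 2) + m * n)%N.
Proof.
elim: m => [|m IHm]; first by rewrite mul0n addn0.
by rewrite addSn !binS !bin1 IHm mulSn; lia.
Qed.

Lemma bin2_sqr n : ('C(n, 2) * 2 + n = n * n)%N.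
Proof. by elim: n => [|n IHn] //; rewrite binS bin1; lia. Qed.

(** In [qbinomial_deriv] at q = X, the terms j = n-k and j = n+1+k carry the same power of X and
    opposite signs; pairing them leaves n+1 terms. *)
Lemma jacobi_finite (R : comNzRingType) n :
  qfact R n ^+ 2 =
  \sum_(k < n.+1) (-1) ^+ k * 'X^('C(k.+1, 2)) *
    (gbin 'X (n + n.+1) (n.+1 + k) *+ (n.+1 + k)
     - gbin 'X (n + n.+1) (n - k) *+ (n - k)).
Proof.
(* The power of X on the left-hand side: n from the leading factor, C(n,2) and n^2 from the two
   products. It is cancelled together with the sign (-1)^n. *)
pose M := (n + 'C(n, 2) + n * n)%N.
have XM : GRing.lreg ('X^M : {poly R}) by apply: monic_lreg; apply: monicXn.
apply: XM; apply: (@lreg_sign _ n).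
have := qbinomial_deriv ('X : {poly R}) n.
rewrite prod_subXn.
have -> : \prod_(i < n) ('X^n - 'X^(n + i.+1)) = 'X^(n * n) * qfact R n.
  have -> : 'X^(n * n) = \prod_(i < n) 'X^n :> {poly R}.
    by rewrite prodr_const card_ord exprM.
  rewrite -big_split /=; by apply: eq_bigr => i _; rewrite exprD; ring.
move=> eqd; transitivity ('X^n * ((-1) ^+ n * 'X^('C(n, 2)) * qfact R n) *
    ('X^(n * n) * qfact R n)).
  by rewrite /M !exprD; ring.
rewrite {}eqd -[(n + n.+1).+1]/(n.+1 + n.+1)%N big_split_ord /=.
rewrite (reindex_inj rev_ord_inj) /= -big_split /= !mulr_sumr.
apply: eq_bigr => -[k /= kn] _; rewrite subSS.
have [d def_n] : exists d, n = (k + d)%N by exists (n - k)%N; lia.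
have -> : (n - k = d)%N by lia.
rewrite -!exprM.
set g1 := gbin _ _ d; set g2 := gbin _ _ (n.+1 + k).
have -> : 'X^('C(d, 2)) * g1 * 'X^(n * (n + n.+1 - d)) =
          'X^M * 'X^('C(k.+1, 2)) * g1.
  rewrite mulrAC -!exprD; congr ('X^ _ * _).
  have -> : (n + n.+1 - d = n + k.+1)%N by lia.
  rewrite /M binS bin1 def_n bin2D; have := bin2_sqr k; nia.
have -> : 'X^('C(n.+1 + k, 2)) * g2 * 'X^(n * (n + n.+1 - (n.+1 + k))) =
          'X^M * 'X^('C(k.+1, 2)) * g2.
  rewrite mulrAC -!exprD; congr ('X^ _ * _).
  have -> : (n + n.+1 - (n.+1 + k) = d)%N by lia.
  rewrite /M addSnnS bin2D; nia.
rewrite addSn /= exprD -[_ *+ d]mulrnAr.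
(* n + k = 2k + d has the parity of d; for d = 0 both sides vanish. *)
have -> : (-1) ^+ d.-1 *+ d = - ((-1) ^+ n * (-1) ^+ k) *+ d :> {poly R}.
case: (d) def_n => [|d'] def_n; first by rewrite !mulr0n.
  rewrite -exprD -(signr_odd _ (n + k)) -(signr_odd _ d'.+1.-1) def_n !oddD /=.
by congr (_ *+ _); case: (odd k); case: (odd d');
    rewrite /= !(expr0, expr1) ?opprK.
move: ('X^M) ('X^('C(k.+1, 2))) ((-1) ^+ n) ((-1) ^+ k) (n + k)%N.+1.
by move=> x y u v w; ring.
Qed.

Definition jacobi_poly (R : nzRingType) (N : nat) : {poly R} :=
  \sum_(k < N) (-1) ^+ k * 'X^('C(k.+1, 2)) *+ k.*2.+1.

(** Far from both ends a Gaussian binomial is 1/E below q^N: all q-factorials in [gbin_qfact] agree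
    there with [qfact R n], and one of them cancels. *)
Lemma gbin_qfact_trunc (R : comNzRingType) N n m j :
  (N <= n)%N -> (N <= j)%N -> (N + j <= m)%N ->
  eqX N (gbin 'X m j * qfact R n) 1.
Proof.
move=> Nn Nj Njm; apply: (eqX_mulIf (qfact_coef0 R n)).
have jm : (j <= m)%N by lia.
have eq_n k : (N <= k)%N -> eqX N (qfact R n) (qfact R k).
  by move=> Nk; apply: eqX_qfact; apply: leqW.
apply: (@eqX_trans _ _ _ (qfact R m)); last first.
  by rewrite mul1r; apply/eqX_sym/eq_n; lia.
rewrite -(gbin_qfact R jm) -!mulrA; do 2!apply: eqXM => //; apply: eq_n; lia.
Qed.

(** One more factor [qfact R n] in [jacobi_finite] turns the Gaussian binomials into 1, so the
    bracket becomes (n+1+k) - (n-k) = 2k+1. The bound on n keeps n-k at least N for k < N; later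
    terms start at q^N or beyond. *)
Lemma qfact_jacobi (R : comNzRingType) N n :
  (N.*2 <= n)%N -> eqX N (qfact R n ^+ 3) (jacobi_poly R N).
Proof.
move=> Nn; rewrite exprSr jacobi_finite mulr_suml.
have Nn1 : (N <= n.+1)%N by lia.
rewrite /jacobi_poly (big_ord_widen _
  (fun k => (-1) ^+ k * 'X^('C(k.+1, 2)) *+ k.*2.+1) Nn1).
rewrite [in X in eqX _ _ X]big_mkcond /=.
apply: eqX_sum => k _; case: ifPn => [kN | ]; last first.
  rewrite -leqNgt => Nk; rewrite [_ ^+ k * _]mulrC -!mulrA; apply: eqX_XnM0.
  by apply: leq_trans Nk _; rewrite binS bin1 leq_addl.
rewrite -[_ * _ * qfact _ _]mulrA -[in X in eqX _ _ X]mulr_natr.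
apply: eqXM => //.
have gq j : (N <= j)%N -> (N + j <= n + n.+1)%N ->
    forall m, eqX N (gbin 'X (n + n.+1) j *+ m * qfact R n) (m%:R).
  move=> Nj jn m; rewrite mulrnAl -mulr_natr -[m%:R in X in eqX _ _ X]mul1r.
  by apply: eqXM => //; apply: gbin_qfact_trunc => //; lia.
move=> i iN; rewrite mulrBl coefB !gq //; try lia.
rewrite -coefB -natrB; last lia.
by congr ((_ %:R : {poly R})`_ _); lia.
Qed.

(** * Exponents and squares *)

Lemma bin2_odd_sqr k : (8 * 'C(k.+1, 2) + 1 = k.*2.+1 * k.*2.+1)%N.
Proof. by have := bin2_sqr k.+1; nia. Qed.

Lemma coef_signM (R : nzRingType) k (A : {poly R}) i :
  ((-1) ^+ k * A)`_i = (-1) ^+ k * A`_i.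
Proof.
rewrite -!(signr_odd _ k); case: (odd k).
  by rewrite !expr1 !mulN1r coefN.
by rewrite !expr0 !mul1r.
Qed.

Lemma jacobi_coef (R : nzRingType) N i : (jacobi_poly R N)`_i != 0 ->
  exists2 y, (8 * i + 1 = y * y)%N & y%:R != 0 :> R.
Proof.
rewrite coef_sum => nz.
have [k /= nzk] : exists k : 'I_N,
    ((-1) ^+ k * 'X^('C(k.+1, 2)) *+ k.*2.+1 : {poly R})`_i != 0.
  apply/existsP; apply: contraR nz; rewrite negb_exists => /forallP z.
  by rewrite big1 // => k _; apply/eqP; have := z k; rewrite negbK.
move: nzk; rewrite coefMn coef_signM coefXn.
case: (i =P _) => [-> | _]; last by rewrite mulr0 mul0rn eqxx.
rewrite mulr1 => nzk; exists k.*2.+1; first exact: bin2_odd_sqr.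
by apply: contraNneq nzk => z; rewrite -mulr_natr z mulr0.
Qed.

Lemma pentagonal_coef (R : nzRingType) n i : (pentagonal_poly R n)`_i != 0 ->
  exists y, (24 * i + 1 = y * y)%N.
Proof.
rewrite coefD coef1; case: i => [|i] /=; first by exists 1%N.
rewrite add0r coef_sum => nz.
have [k /= nzk] : exists k : 'I_n,
    ((-1) ^+ k.+1 * ('X^(k.+1 * k.+1 + 'C(k.+1, 2))
       + 'X^(k.+1 * k.+1 + 'C(k.+2, 2))) : {poly R})`_i.+1 != 0.
  apply/existsP; apply: contraR nz; rewrite negb_exists => /forallP z.
  by rewrite big1 // => k _; apply/eqP; have := z k; rewrite negbK.
move: nzk; rewrite coef_signM coefD !coefXn.
have := bin2_sqr k.+1; have := bin2_sqr k.+2.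
(* For m = k+1, 24 m(3m-1)/2 + 1 = (6m-1)^2; the other exponent gives (6m+1)^2. *)
case: (_.+1 =P _) => [-> | _] h2 h1; first by exists (6 * k + 5)%N; nia.
case: (_.+1 =P _) => [-> | _]; first by exists (6 * k + 7)%N; nia.
by rewrite addr0 mulr0 eqxx.
Qed.

(** * Residue classes of exponents modulo p *)

Definition suppX (R : nzRingType) (p N : nat) (S : seq nat) (A : {poly R}) :=
  forall i, (i < N)%N -> A`_i != 0 -> (i %% p)%N \in S.

Lemma suppX_coef0 (R : nzRingType) p N S (A : {poly R}) i :
  suppX p N S A -> (i < N)%N -> (i %% p)%N \notin S -> A`_i = 0.
Proof. by move=> SA iN; apply: contraNeq; apply: SA. Qed.

Lemma suppX_eqX (R : nzRingType) p N S (A B : {poly R}) :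
  eqX N A B -> suppX p N S A -> suppX p N S B.
Proof. by move=> AB SA i iN; rewrite -AB //; apply: SA. Qed.

Lemma suppX_sum (R : nzRingType) p N S (I : eqType) (r : seq I)
    (F : I -> {poly R}) :
  (forall i, i \in r -> suppX p N S (F i)) -> suppX p N S (\sum_(i <- r) F i).
Proof.
move=> SF i iN; apply: contraR => iS; rewrite coef_sum big_seq big1 // => j jr.
exact: suppX_coef0 (SF j jr) iN iS.
Qed.

Lemma suppXM (R : nzRingType) p N S T (A B : {poly R}) :
  suppX p N S A -> suppX p N T B ->
  suppX p N [seq ((s + t) %% p)%N | s <- S, t <- T] (A * B).
Proof.
move=> SA TB i iN; apply: contraR => iU; rewrite coefM big1 // => j _.
have ji : (j <= i)%N by rewrite -ltnS.
have [-> | nzA] := eqVneq A`_j 0; first by rewrite mul0r.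
have [-> | nzB] := eqVneq B`_(i - j) 0; first by rewrite mulr0.
case/negP: iU; apply/allpairsP; exists (j %% p, (i - j) %% p)%N; split=> /=.
- by apply: SA => //; apply: leq_ltn_trans iN.
- by apply: TB => //; apply: leq_ltn_trans (leq_subr _ _) iN.
- by rewrite modnDm subnKC.
Qed.

(** Dividing by a series in q^p with constant term 1 keeps the residue classes: a nonzero term at j
    < i in the convolution forces j = i modulo p, where induction applies. *)
Lemma suppX_mulI (R : nzRingType) p N S (A U : {poly R}) :
  U`_0 = 1 -> suppX p N [:: 0%N] U ->
  suppX p N S (A * U) -> suppX p N S A.
Proof.
move=> U0 SU SAU i; elim/ltn_ind: i => i IHi iN; apply: contraR => iS.
have := suppX_coef0 SAU iN iS.
rewrite coefM big_ord_recr /= subnn U0 mulr1 big1 ?add0r => [->//|j _].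
have ji := ltn_ord j; have [-> | nzA] := eqVneq A`_j 0; first by rewrite mul0r.
have [-> | nzU] := eqVneq U`_(i - j) 0; first by rewrite mulr0.
have := SU _ (leq_ltn_trans (leq_subr _ _) iN) nzU; rewrite inE => /eqP ij.
case/negP: iS; rewrite -(subnKC (ltnW ji)) -modnDmr ij addn0.
by apply: IHi => //; apply: ltn_trans iN.
Qed.

(** A computed list, so that membership for a concrete p is settled by evaluation. *)
Definition residues (c p : nat) (T : seq nat) : seq nat :=
  [seq r <- iota 0 p | has (fun z => c * r + 1 == z * z %[mod p])%N T].

Lemma mem_residues c p i y (T : seq nat) : (0 < p)%N ->
  (c * i + 1 = y * y)%N -> (y %% p)%N \in T -> (i %% p)%N \in residues c p T.
Proof.
move=> p0 ciy yT; rewrite mem_filter mem_iota add0n ltn_pmod // !andbT.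
apply/hasP; exists (y %% p)%N => //.
by rewrite modnMm -ciy -modnDml modnMmr modnDml.
Qed.

Lemma suppX_qfact (R : comNzRingType) p N n : (0 < p)%N -> (N <= n.+1)%N ->
  suppX p N (residues 24 p (iota 0 p)) (qfact R n).
Proof.
move=> p0 Nn.
apply: (suppX_eqX (eqXW Nn (eqX_sym (@qfact_pentagonal R n)))) => i iN.
case/pentagonal_coef => y /mem_residues; apply => //.
by rewrite mem_iota ltn_pmod.
Qed.

Lemma suppX_jacobi (p : nat) (R : nzRingType) N : p \in [pchar R] ->
  suppX p N (residues 8 p (iota 1 p.-1)) (jacobi_poly R N).
Proof.
move=> pR i iN; case/jacobi_coef => y iy nzy.
have p0 := prime_gt0 (pcharf_prime pR).
apply: mem_residues iy _ => //; rewrite mem_iota add1n prednK // ltn_pmod //.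
by rewrite andbT lt0n -/(dvdn p y) (dvdn_pcharf pR).
Qed.

Lemma suppX_qfact_exp3 (p : nat) (R : comNzRingType) N n :
  p \in [pchar R] -> (N <= n.+1)%N ->
  suppX p N (residues 8 p (iota 1 p.-1)) (qfact R n ^+ 3).
Proof.
move=> pR Nn; apply: (suppX_eqX _ (@suppX_jacobi p R N pR)).
apply: eqX_trans (eqX_sym (@qfact_jacobi R N (N.*2 + n) _)) _; first by lia.
by apply: eqX_exp; apply: eqX_qfact => //; lia.
Qed.

(** * The moduli 5 and 7 *)

(** Modulo 5 the classes are 0, 1 for E^3 and 0, 1, 2 for E; no sum is 4. *)
Lemma qfact_exp4_mod5 n i : (i <= n)%N -> (i %% 5 = 4)%N ->
  (qfact 'F_5 n ^+ 4)`_i = 0.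
Proof.
move=> le_in i4; have p5 : 5 \in [pchar 'F_5] by apply: pchar_Fp.
have := suppXM (suppX_qfact_exp3 p5 (leqnn n.+1))
                (@suppX_qfact 'F_5 5 n.+1 n isT (leqnn _)).
by rewrite -exprSr => /suppX_coef0; apply; rewrite ?ltnS // i4.
Qed.

(** Modulo 7 the classes of E^3 are 0, 1, 3; no sum of two is 5. *)
Lemma qfact_exp6_mod7 n i : (i <= n)%N -> (i %% 7 = 5)%N ->
  (qfact 'F_7 n ^+ 6)`_i = 0.
Proof.
move=> le_in i5; have p7 : 7 \in [pchar 'F_7] by apply: pchar_Fp.
have S3 := suppX_qfact_exp3 p7 (leqnn n.+1).
have := suppXM S3 S3.
by rewrite -exprD => /suppX_coef0; apply; rewrite ?ltnS // i5.
Qed.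

(** * The modulus 11 *)

(* A list of pairs (c, w) encodes sum_(c,w) c prod_(r in w) x_r. *)
Definition wsum (A : nzRingType) (x : nat -> A) (L : seq (nat * seq nat)) : A :=
  \sum_(t <- L) (\prod_(r <- t.2) x r) *+ t.1.

(* Component k of (x_0 + x_1 + x_3 + x_6 + x_10)^3, where x_r has weight r
   modulo 11. *)
Definition cubics : seq (seq (nat * seq nat)) := [::
    [:: (1, [:: 0; 0; 0]); (6, [:: 0; 1; 10]); (3, [:: 6; 6; 10])];
    [:: (3, [:: 0; 0; 1]); (3, [:: 0; 6; 6]); (3, [:: 1; 1; 10]);
        (3, [:: 3; 3; 6]); (3, [:: 3; 10; 10])];
    [:: (3, [:: 0; 1; 1]); (6, [:: 0; 3; 10]); (3, [:: 1; 6; 6])];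
    [:: (3, [:: 0; 0; 3]); (1, [:: 1; 1; 1]); (6, [:: 1; 3; 10])];
    [:: (6, [:: 0; 1; 3]); (3, [:: 3; 6; 6]); (3, [:: 6; 10; 10])];
    [:: (6, [:: 0; 6; 10]); (3, [:: 1; 1; 3]); (3, [:: 3; 3; 10])];
    [:: (3, [:: 0; 0; 6]); (3, [:: 0; 3; 3]); (6, [:: 1; 6; 10])];
    [:: (6, [:: 0; 1; 6]); (3, [:: 1; 3; 3]); (1, [:: 6; 6; 6])];
    [:: (3, [:: 1; 1; 6]); (6, [:: 3; 6; 10]); (1, [:: 10; 10; 10])];
    [:: (6, [:: 0; 3; 6]); (3, [:: 0; 10; 10]); (1, [:: 3; 3; 3])];
    [:: (3, [:: 0; 0; 10]); (6, [:: 1; 3; 6]); (3, [:: 1; 10; 10])]]%N.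

(** The components of the fourth power of the same sum. *)
Definition quartics : seq (seq (nat * seq nat)) := [::
    [:: (1, [:: 0; 0; 0; 0]); (12, [:: 0; 0; 1; 10]); (12, [:: 0; 6; 6; 10]);
        (12, [:: 1; 1; 3; 6]); (6, [:: 1; 1; 10; 10]);
        (12, [:: 3; 3; 6; 10]); (4, [:: 3; 10; 10; 10])];
    [:: (4, [:: 0; 0; 0; 1]); (6, [:: 0; 0; 6; 6]); (12, [:: 0; 1; 1; 10]);
        (12, [:: 0; 3; 3; 6]); (12, [:: 0; 3; 10; 10]);
        (12, [:: 1; 6; 6; 10]); (1, [:: 3; 3; 3; 3])];
    [:: (6, [:: 0; 0; 1; 1]); (12, [:: 0; 0; 3; 10]); (12, [:: 0; 1; 6; 6]);
        (4, [:: 1; 1; 1; 10]); (12, [:: 1; 3; 3; 6]);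
        (12, [:: 1; 3; 10; 10]); (1, [:: 6; 6; 6; 6])];
    [:: (4, [:: 0; 0; 0; 3]); (4, [:: 0; 1; 1; 1]); (24, [:: 0; 1; 3; 10]);
        (6, [:: 1; 1; 6; 6]); (12, [:: 3; 6; 6; 10]);
        (4, [:: 6; 10; 10; 10])];
    [:: (12, [:: 0; 0; 1; 3]); (12, [:: 0; 3; 6; 6]);
        (12, [:: 0; 6; 10; 10]); (1, [:: 1; 1; 1; 1]);
        (12, [:: 1; 1; 3; 10]); (4, [:: 3; 3; 3; 6]); (6, [:: 3; 3; 10; 10])];
    [:: (12, [:: 0; 0; 6; 10]); (12, [:: 0; 1; 1; 3]);
        (12, [:: 0; 3; 3; 10]); (12, [:: 1; 3; 6; 6]);
        (12, [:: 1; 6; 10; 10])];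
    [:: (4, [:: 0; 0; 0; 6]); (6, [:: 0; 0; 3; 3]); (24, [:: 0; 1; 6; 10]);
        (4, [:: 1; 1; 1; 3]); (12, [:: 1; 3; 3; 10]); (4, [:: 6; 6; 6; 10])];
    [:: (12, [:: 0; 0; 1; 6]); (12, [:: 0; 1; 3; 3]); (4, [:: 0; 6; 6; 6]);
        (12, [:: 1; 1; 6; 10]); (6, [:: 3; 3; 6; 6]);
        (12, [:: 3; 6; 10; 10]); (1, [:: 10; 10; 10; 10])];
    [:: (12, [:: 0; 1; 1; 6]); (24, [:: 0; 3; 6; 10]);
        (4, [:: 0; 10; 10; 10]); (6, [:: 1; 1; 3; 3]); (4, [:: 1; 6; 6; 6]);
        (4, [:: 3; 3; 3; 10])];
    [:: (12, [:: 0; 0; 3; 6]); (6, [:: 0; 0; 10; 10]); (4, [:: 0; 3; 3; 3]);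
        (4, [:: 1; 1; 1; 6]); (24, [:: 1; 3; 6; 10]);
        (4, [:: 1; 10; 10; 10])];
    [:: (4, [:: 0; 0; 0; 10]); (24, [:: 0; 1; 3; 6]);
        (12, [:: 0; 1; 10; 10]); (4, [:: 1; 3; 3; 3]); (4, [:: 3; 6; 6; 6]);
        (6, [:: 6; 6; 10; 10])]]%N.

(* Found by linear algebra modulo 11: the component of weight 6 of the seventh
   power is minus the combination of the quartics with these coefficients. *)
Definition relation_coefs : seq (seq (nat * seq nat)) := [::
    [::];
    [::];
    [::];
    [:: (7, [:: 0; 0; 3]); (1, [:: 1; 1; 1]); (1, [:: 1; 3; 10])];
    [::];
    [::];
    [:: (1, [:: 0; 0; 0]); (1, [:: 0; 1; 10]); (7, [:: 6; 6; 10])];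
    [::];
    [:: (1, [:: 0; 3; 6]); (7, [:: 0; 10; 10]); (1, [:: 3; 3; 3])];
    [:: (7, [:: 1; 1; 6]); (1, [:: 3; 6; 10]); (1, [:: 10; 10; 10])];
    [:: (1, [:: 0; 1; 6]); (7, [:: 1; 3; 3]); (1, [:: 6; 6; 6])]]%N.

(** The cofactor of 11, which makes the relation an integral identity that [ring] can check. *)
Definition relation_quotient : seq (nat * seq nat) :=
  [:: (1, [:: 0; 0; 0; 0; 0; 0; 6]); (5, [:: 0; 0; 0; 0; 0; 3; 3]);
      (22, [:: 0; 0; 0; 0; 1; 6; 10]); (16, [:: 0; 0; 0; 1; 1; 1; 3]);
      (58, [:: 0; 0; 0; 1; 3; 3; 10]); (16, [:: 0; 0; 0; 6; 6; 6; 10]);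
      (72, [:: 0; 0; 1; 1; 3; 6; 6]); (72, [:: 0; 0; 1; 1; 6; 10; 10]);
      (72, [:: 0; 0; 3; 3; 6; 6; 10]); (58, [:: 0; 0; 3; 6; 10; 10; 10]);
      (5, [:: 0; 0; 10; 10; 10; 10; 10]); (1, [:: 0; 1; 1; 1; 1; 1; 1]);
      (22, [:: 0; 1; 1; 1; 1; 3; 10]); (58, [:: 0; 1; 1; 3; 3; 3; 6]);
      (72, [:: 0; 1; 1; 3; 3; 10; 10]); (22, [:: 0; 1; 3; 6; 6; 6; 6]);
      (58, [:: 0; 1; 6; 6; 6; 10; 10]); (22, [:: 0; 3; 3; 3; 3; 6; 10]);
      (16, [:: 0; 3; 3; 3; 10; 10; 10]); (5, [:: 1; 1; 1; 1; 1; 6; 6]);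
      (58, [:: 1; 1; 1; 3; 6; 6; 10]); (16, [:: 1; 1; 1; 6; 10; 10; 10]);
      (5, [:: 1; 1; 3; 3; 3; 3; 3]); (16, [:: 1; 3; 3; 3; 6; 6; 6]);
      (72, [:: 1; 3; 3; 6; 6; 10; 10]); (22, [:: 1; 3; 6; 10; 10; 10; 10]);
      (1, [:: 1; 10; 10; 10; 10; 10; 10]); (1, [:: 3; 3; 3; 3; 3; 3; 10]);
      (1, [:: 3; 6; 6; 6; 6; 6; 6]); (5, [:: 6; 6; 6; 6; 6; 10; 10])]%N.

Lemma cubics_expand (A : comNzRingType) (x : nat -> A) :
  (\sum_(r <- [:: 0; 1; 3; 6; 10]%N) x r) ^+ 3 =
  \sum_(k < 11) wsum x (nth [::] cubics k).
Proof.
rewrite !big_ord_recr big_ord0 /wsum unlock /=.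
move: (x 0) (x 1) (x 3) (x 6) (x 10) => x0 x1 x3 x6 x10; ring.
Qed.

Lemma quartics_expand (A : comNzRingType) (x : nat -> A) :
  (\sum_(r <- [:: 0; 1; 3; 6; 10]%N) x r) ^+ 4 =
  \sum_(k < 11) wsum x (nth [::] quartics k).
Proof.
rewrite !big_ord_recr big_ord0 /wsum unlock /=.
move: (x 0) (x 1) (x 3) (x 6) (x 10) => x0 x1 x3 x6 x10; ring.
Qed.

(** The first sum is the component of weight 6 of the seventh power; 17 - k stands for 6 - k modulo
    11 without truncated subtraction. *)
Lemma septic_relation (A : comNzRingType) (x : nat -> A) :
  \sum_(k < 11) wsum x (nth [::] cubics ((17 - k) %% 11)) *
    wsum x (nth [::] quartics k)
  + \sum_(k < 11) wsum x (nth [::] relation_coefs k) *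
    wsum x (nth [::] quartics k) = 11%:R * wsum x relation_quotient.
Proof.
rewrite !big_ord_recr !big_ord0 /= /wsum unlock /=.
move: (x 0) (x 1) (x 3) (x 6) (x 10) => x0 x1 x3 x6 x10; ring.
Qed.

Lemma suppX_wsum (R : nzRingType) p N (x : nat -> {poly R}) k
    (L : seq (nat * seq nat)) :
  (forall r, suppX p N [:: (r %% p)%N] (x r)) ->
  all (fun t => sumn t.2 %% p == k)%N L -> suppX p N [:: k] (wsum x L).
Proof.
move=> Sx /allP Lk; apply: suppX_sum => -[c w] /Lk /= /eqP <- i iN.
rewrite coefMn => nz.
have {nz} : (\prod_(r <- w) x r)`_i != 0.
  by apply: contraNneq nz => ->; rewrite mul0rn.
elim: w i iN => [|r w IHw] i iN; rewrite ?big_nil ?big_cons.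
  by rewrite coef1; case: i iN => [|i] _; rewrite /= ?inE ?eqxx.
by have := suppXM (Sx r) IHw => /(_ i iN) /=; rewrite modnDm.
Qed.

Lemma coef_suppX_sum (R : nzRingType) p N (F : nat -> {poly R}) i :
  (forall k, (k < p)%N -> suppX p N [:: k] (F k)) -> (0 < p)%N -> (i < N)%N ->
  (\sum_(k < p) F k)`_i = (F (i %% p)%N)`_i.
Proof.
move=> SF p0 iN; rewrite coef_sum.
rewrite (bigD1 (Ordinal (ltn_pmod i p0))) //= big1 ?addr0 // => k ki.
apply: suppX_coef0 (SF k (ltn_ord k)) iN _.
by rewrite inE eq_sym; apply: contraNneq ki => ik; apply/eqP/val_inj.
Qed.

Definition residue_part (R : nzRingType) (p r : nat) (A : {poly R}) :
    {poly R} :=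
  \poly_(i < size A) (if i == r %[mod p] then A`_i else 0).

Lemma coef_residue_part (R : nzRingType) p r (A : {poly R}) i :
  (residue_part p r A)`_i = if i == r %[mod p] then A`_i else 0.
Proof.
rewrite coef_poly; case: ltnP => // /leq_sizeP/(_ i (leqnn i)) ->.
by case: ifP.
Qed.

Lemma suppX_residue_part (R : nzRingType) p N r (A : {poly R}) :
  suppX p N [:: (r %% p)%N] (residue_part p r A).
Proof.
move=> i _; rewrite coef_residue_part inE; case: ifP => // _.
by rewrite eqxx.
Qed.

Lemma exprB1_pchar (A : comNzRingType) p (y : A) : p \in [pchar A] ->
  (1 - y) ^+ p = 1 - y ^+ p.
Proof.
move=> pA; have := pFrobenius_autB_comm pA (mulrC 1 y).
by rewrite !pFrobenius_autE expr1n.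
Qed.

(** By Frobenius each factor 1 - X^i becomes 1 - X^(pi). *)
Lemma suppX_frobenius (R : comNzRingType) p N n : p \in [pchar R] ->
  suppX p N [:: 0%N] (qfact R n ^+ p).
Proof.
move=> pR; rewrite /qfact -prodrXl.
elim/big_ind: _ => [i _ | A B SA SB | k _ i _].
- by rewrite coef1; case: i => [|i]; rewrite ?mod0n ?eqxx.
- by have := suppXM SA SB; rewrite /= mod0n.
rewrite exprB1_pchar ?pchar_poly // -exprM coefB coef1 coefXn.
case: i => [|i]; first by rewrite mod0n.
case: (_.+1 =P (_ * _)%N) => [->|_]; first by rewrite modnMl.
by rewrite subrr eqxx.
Qed.

Lemma qfact_exp10_mod11 n i : (i <= n)%N -> (i %% 11 = 6)%N ->
  (qfact 'F_11 n ^+ 10)`_i = 0.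
Proof.
have p11 : 11 \in [pchar 'F_11] by apply: pchar_Fp.
have S0 := @suppX_frobenius _ _ n.+1 n p11.
have S4 := suppXM S0 (@suppX_qfact 'F_11 11 n.+1 n isT (leqnn _)).
rewrite -exprSr in S4.
pose J := qfact 'F_11 n ^+ 3.
pose x r := residue_part 11 r J.
pose C k := wsum x (nth [::] cubics k).
pose Q k := wsum x (nth [::] quartics k).
have Sx r : suppX 11 n.+1 [:: r %% 11]%N (x r) by apply: suppX_residue_part.
have SC k : (k < 11)%N -> suppX 11 n.+1 [:: k] (C k).
  move=> k11; apply: suppX_wsum => //; move: k k11.
  have /allP TT : all (fun k => all (fun t => sumn t.2 %% 11 == k)%N
      (nth [::] cubics k)) (iota 0 11) by [].
  by move=> k k11; apply: TT; rewrite mem_iota.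
have SQ k : (k < 11)%N -> suppX 11 n.+1 [:: k] (Q k).
  move=> k11; apply: suppX_wsum => //; move: k k11.
  have /allP TT : all (fun k => all (fun t => sumn t.2 %% 11 == k)%N
      (nth [::] quartics k)) (iota 0 11) by [].
  by move=> k k11; apply: TT; rewrite mem_iota.
have JX : eqX n.+1 J (\sum_(r <- [:: 0; 1; 3; 6; 10]%N) x r).
  move=> j jn; rewrite coef_sum !big_cons big_nil !coef_residue_part.
  have [-> | nzJ] := eqVneq J`_j 0; first by rewrite !if_same !addr0.
  have := suppX_qfact_exp3 p11 (leqnn n.+1) jn nzJ; rewrite /= !inE.
  by do 4?[case/predU1P=> [->|]]; [..|move/eqP->]; rewrite /= ?add0r ?addr0.
(* These five classes are the ones missed by E, hence by J^4 = E^11 E. *)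
have Q0 k : k \in [:: 3; 6; 8; 9; 10]%N -> eqX n.+1 (Q k) 0.
  move=> kS j jn; rewrite coef0.
  have k11 : (k < 11)%N by move: kS; rewrite !inE; lia.
  have [jk | njk] := eqVneq (j %% 11)%N k; last first.
    by apply: suppX_coef0 (SQ k k11) jn _; rewrite inE.
  have := coef_suppX_sum SQ isT jn; rewrite jk => <-.
  rewrite -quartics_expand -(eqX_exp 4 JX) // -exprM.
  apply: suppX_coef0 S4 jn _; rewrite jk.
  by move: kS; rewrite !inE; do 4?[case/predU1P=> [->|] //]; move/eqP->.
have J6 j : (j < n.+1)%N -> (j %% 11 = 6)%N -> (J ^+ 7)`_j = 0.
  move=> jn j6; rewrite (eqX_exp 7 JX) // (exprD _ 3 4).
  rewrite cubics_expand quartics_expand -/C -/Q.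
  (* Only weights adding up to 6 modulo 11 contribute to the coefficient at j. *)
  transitivity (\sum_(k < 11) C ((17 - k) %% 11)%N * Q k)`_j.
    rewrite mulr_sumr !coef_sum; apply: eq_bigr => k _.
    rewrite mulr_suml coef_sum.
    rewrite (bigD1 (Ordinal (ltn_pmod (17 - k) (isT : 0 < 11)%N))) //=.
    rewrite big1 ?addr0 // => a ak.
    apply: suppX_coef0 (suppXM (SC a _) (SQ k _)) jn _ => //.
    rewrite /= inE j6; apply: contraNN ak => ak; apply/eqP/val_inj => /=.
    have := ltn_ord a; have := ltn_ord k; lia.
  have /(congr1 (fun A : {poly 'F_11} => A`_j)) := septic_relation x.
  rewrite /= -/C -/Q.
  rewrite pcharf0 ?pchar_poly // mul0r coefD coef0 => rel.
  rewrite -[LHS]addr0 -[RHS]rel; congr (_ + _); rewrite coef_sum big1 // => k _.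
  (* Either the quartic vanishes or its coefficient in the relation is empty. *)
  have [kS | kS] := boolP (val k \in [:: 3; 6; 8; 9; 10]%N).
    rewrite (@eqXM _ n.+1 _ (wsum x (nth [::] relation_coefs k)) _ 0) //.
      by rewrite mulr0 coef0.
    exact: Q0.
  suff -> : nth [::] relation_coefs k = [::].
    by rewrite /wsum big_nil mul0r coef0.
  have /allP relS : all (fun k => (k \notin [:: 3; 6; 8; 9; 10]) ==>
      nilp (nth [::] relation_coefs k))%N (iota 0 11) by [].
  by apply/nilP; apply: (implyP (relS k _)) => //; rewrite mem_iota ltn_ord.
have SJ7 : suppX 11 n.+1 [:: 0; 1; 2; 3; 4; 5; 7; 8; 9; 10]%N (J ^+ 7).
  move=> j jn; apply: contraR => jS; apply/eqP/J6 => //.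
  by move: jS; rewrite !inE; have := ltn_pmod j (isT : 0 < 11)%N; lia.
(* J^7 = E^21 = E^10 E^11, from which E^11 is then cancelled. *)
rewrite -exprM (exprD _ 10 11) in SJ7.
have U0 : (qfact 'F_11 n ^+ 11)`_0 = 1.
  by rewrite -horner_coef0 horner_exp horner_coef0 qfact_coef0 expr1n.
by move=> le_in i6; apply: suppX_coef0 (suppX_mulI U0 S0 SJ7) _ _; rewrite ?i6.
Qed.

(** * The generating function of a(n,p) modulo p *)

(** Index i marks the part whose multiplicity is counted; expanding the product of sums yields one
    monomial per multiplicity function. *)
Lemma a_generating (R : comNzRingType) n p :
  (a n p)%:R =
  (\sum_(i < n | (p %| i.+1)%N) (\sum_(k < p.-1.+1) 'X^(i.+1) ^+ k *+ k) *
     \prod_(j < n | j != i) \sum_(k < p.-1.+1) 'X^(j.+1) ^+ k : {poly R})`_n.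
Proof.
pose w (f : {ffun 'I_n -> 'I_p.-1.+1}) := (\sum_(i < n) i.+1 * f i)%N.
transitivity (\sum_(i < n | (p %| i.+1)%N)
                \sum_f ('X^(w f) *+ f i : {poly R})`_n).
  rewrite a_multiplicities natr_sum big_mkcond exchange_big /=.
  apply: eq_bigr => f _; rewrite -/(w f).
  under [RHS]eq_bigr => i _ do rewrite coefMn coefXn.
  rewrite -sumrMnr [_ == n]eq_sym; case: (n =P _) => _ //=.
  by rewrite big1 // => i _; rewrite mul0rn.
rewrite coef_sum; apply: eq_bigr => i _; rewrite -coef_sum.
congr (polyseq _)`_n.
pose F (j : 'I_n) (k : 'I_p.-1.+1) : {poly R} :=
  'X^(j.+1) ^+ k *+ (if j == i then k : nat else 1%N).
transitivity (\prod_j \sum_k F j k); last first.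
  rewrite (bigD1 i) //=; congr (_ * _).
    by apply: eq_bigr => k _; rewrite /F eqxx.
  by apply: eq_bigr => j ji; apply: eq_bigr => k _; rewrite /F (negPf ji).
rewrite bigA_distr_bigA; apply: eq_bigr => f _.
rewrite /w -prodrXr (bigD1 i) //= [RHS](bigD1 i) //= /F eqxx mulrnAl exprM.
congr (_ * _ *+ _); apply: eq_bigr => j ji.
by rewrite (negPf ji) exprM.
Qed.

Lemma sum_expMn (A : comNzRingType) (x : A) m :
  (\sum_(k < m) x ^+ k *+ k) * (1 - x) =
  x * (\sum_(k < m) x ^+ k) - x ^+ m *+ m.
Proof.
elim: m => [|m IHm]; first by rewrite !big_ord0 mul0r mulr0 mulr0n subr0.
rewrite !big_ord_recr /= mulrDl IHm exprS !mulrSr; ring.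
Qed.

(** Times 1 - x, both sides equal 1 - x^p; this factor is cancelled at every truncation order. *)
Lemma sum_exp_pchar (R : comNzRingType) p m : p \in [pchar R] ->
  \sum_(k < p) 'X^(m.+1) ^+ k = (1 - 'X^(m.+1)) ^+ p.-1 :> {poly R}.
Proof.
move=> pR; have p_gt0 := prime_gt0 (pcharf_prime pR).
apply/polyP => i; apply: (@eqX_mulIf R i.+1 (1 - 'X^(m.+1))) => //.
  by rewrite coefB coef1 coefXn subr0.
move=> j _; congr (polyseq _)`_j.
rewrite -exprSr prednK // exprB1_pchar ?pchar_poly // -[RHS]opprB subrX1; ring.
Qed.

(** Writing x (1-x)^(p-2) as x/(1-x) times (1-x)^(p-1) leaves the same factor as for unmarked parts.
    The geometric series x/(1-x) is cut after n terms, with error beyond q^n. *)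
Lemma sum_expMn_pchar (R : comNzRingType) p n m : p \in [pchar R] ->
  eqX n.+1 (\sum_(k < p) 'X^(m.+1) ^+ k *+ k)
    ((\sum_(l < n) 'X^(m.+1 * l.+1)) * (1 - 'X^(m.+1)) ^+ p.-1 : {poly R}).
Proof.
move=> pR; apply: (@eqX_mulIf R n.+1 (1 - 'X^(m.+1))).
  by rewrite coefB coef1 coefXn subr0.
rewrite sum_expMn sum_exp_pchar // -mulr_natr pcharf0 ?pchar_poly //.
rewrite mulr0 subr0.
have -> : (\sum_(l < n) 'X^(m.+1 * l.+1)) * (1 - 'X^(m.+1)) ^+ p.-1 *
    (1 - 'X^(m.+1)) = ('X^(m.+1) - 'X^(n.+1) * 'X^(m * n.+1)) *
    (1 - 'X^(m.+1)) ^+ p.-1 :> {poly R}.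
  rewrite mulrAC; congr (_ * _); rewrite -exprD -mulSn (exprM _ m.+1 n.+1).
  under eq_bigr => l _ do rewrite exprM.
  move: ('X^(m.+1) : {poly R}) => y.
  under eq_bigr => l _ do rewrite exprS.
  rewrite -mulr_sumr -mulrA [_ * (1 - y)]mulrC -[1 - y]opprB mulNr -subrX1.
  by rewrite exprS; ring.
apply: eqXM => // i iN; rewrite coefB.
by rewrite (@eqX_XnM0 _ n.+1 n.+1 _ (leqnn _)) // coef0 subr0.
Qed.

Lemma a_eq0_pchar (R : comNzRingType) n p : p \in [pchar R] ->
  (forall i, (i <= n)%N -> i = n %[mod p] -> (qfact R n ^+ p.-1)`_i = 0) ->
  (a n p)%:R = 0 :> R.
Proof.
move=> pR Z; have p_gt0 := prime_gt0 (pcharf_prime pR).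
rewrite a_generating prednK //.
(* The truncated sum of x/(1-x) over parts divisible by p: a series in q^p. *)
pose S : {poly R} :=
  \sum_(i < n | (p %| i.+1)%N) \sum_(l < n) 'X^(i.+1 * l.+1).
have S0 : suppX p n.+1 [:: 0%N] S.
  rewrite /S -big_filter; apply: suppX_sum => i.
  rewrite mem_filter => /andP[pi _]; apply: suppX_sum => l _ j _.
  rewrite coefXn inE; case: (j =P _) => [-> _ | _]; last by rewrite eqxx.
  by rewrite -/(dvdn _ _) dvdn_mulr.
rewrite (_ : _`_n = (S * qfact R n ^+ p.-1)`_n).
  rewrite coefM big1 // => j _; have jn : (j <= n)%N by rewrite -ltnS.
  have [-> | nzS] := eqVneq S`_j 0; first by rewrite mul0r.
  rewrite Z ?mulr0 ?leq_subr //.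
  have := S0 j jn nzS; rewrite inE => /eqP j0.
  by rewrite -[in RHS](subnKC jn) -modnDml j0.
suff: eqX n.+1
    (\sum_(i < n | (p %| i.+1)%N) (\sum_(k < p) 'X^(i.+1) ^+ k *+ k) *
       \prod_(j < n | j != i) \sum_(k < p) 'X^(j.+1) ^+ k)
    (S * qfact R n ^+ p.-1).
  by apply.
rewrite /S mulr_suml; apply: eqX_sum => i _.
rewrite /qfact -prodrXl [\prod_(j < n) _](bigD1 i) //= mulrA; apply: eqXM.
  exact: sum_expMn_pchar.
by under eq_bigr => j _ do rewrite sum_exp_pchar //.
Qed.

Local Close Scope ring_scope.

Theorem theorem4 (n : nat) :
  [/\ a (5 * n + 4) 5 = 0 %[mod 5],
      a (7 * n + 5) 7 = 0 %[mod 7]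
    & a (11 * n + 6) 11 = 0 %[mod 11]].
Proof.
have a_mod p (m : nat) : prime p ->
    (forall i, i <= m -> i = m %[mod p] ->
       ((qfact 'F_p m ^+ p.-1)`_i = 0)%R) ->
    a m p = 0 %[mod p].
  move=> p_pr Z; have pF := pchar_Fp p_pr; apply/eqP.
  by rewrite mod0n -/(dvdn _ _) (dvdn_pcharf pF) (a_eq0_pchar pF Z).
split; apply: a_mod => // i im ir.
- by apply: qfact_exp4_mod5 => //; rewrite ir mulnC modnMDl.
- by apply: qfact_exp6_mod7 => //; rewrite ir mulnC modnMDl.
- by apply: qfact_exp10_mod11 => //; rewrite ir mulnC modnMDl.
Qed.
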